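(* For all integers $n\geq 1$ and $0\leq k\leq n-1$, $$Q_{n,k}(x-t-1,t)=\sum_{T\in \mathcal P_{n,k}}x^{\mathrm{young}_T(1)}\,t^{\mathrm{eld}(T)}.$$
   Context: Define polynomials $Q_n(x,y,z,t)$ by $Q_1=1$ and $Q_{n+1}=[x+nz+(y+t)(n+y\partial_y)]Q_n$ for $n\ge1$, and define $Q_{n,k}(x,t)$ by $Q_n(x,y,1,t)=\sum_{k=0}^{n-1}Q_{n,k}(x,t)y^k$. All trees are rooted trees whose vertices are labeled by distinct positive integers. A vertex $j$ is a descendant of $i$ if the path from the root to $j$ passes through $i$ (every vertex is a descendant of itself); $\beta_T(i)$ is the smallest descendant of $i$ in $T$. If $j$ is a descendant of $i$ joined to $i$ by an edge, $j$ is a child of $i$ and the edge is written $(i,j)$; two children of the same vertex are brothers. A plane tree is a rooted tree in which the children of each vertex are linearly ordered (left to right). In a plane tree $T$, a vertex $j$ is elder if it has a brother $k$ to its right with $\beta_T(k)<\beta_T(j)$; otherwise $j$ is younger. $\mathrm{eld}_T(v)$ is the number of elder children of $v$, $\mathrm{eld}(T)$ is the total number of elder vertices of $T$, $\deg_T(v)$ is the number of children of $v$, and $\mathrm{young}_T(v)=\deg_T(v)-\mathrm{eld}_T(v)$. An edge $(i,j)$ is proper if $j$ is an elder child of $i$ or $i<\beta_T(j)$; otherwise it is improper. $\mathcal P_{n,k}$ denotes the set of plane trees on vertex set $[n]=\{1,\dots,n\}$ (with arbitrary root) having exactly $k$ improper edges; $\mathrm{young}_T(1)$ refers to the vertex labeled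 $1$. *)

(* Defs.v *)
From mathcomp Require Import all_boot all_order all_algebra.
From mathcomp Require Import mpoly.
Set Implicit Arguments. Unset Strict Implicit. Unset Printing Implicit Defensive.
Import GRing.Theory.
Local Open Scope ring_scope.

(* ---------- The polynomials Q_n(x,y,z,t) ---------------------------------
   Q_n is represented as an element of {poly {mpoly int[3]}}: a univariate
   polynomial in y (the polynomial variable 'X) whose coefficients are
   polynomials in x = 'X_0, z = 'X_1, t = 'X_2.  y * d/dy is 'X * p^`(). *)

Notation MP3 := {mpoly int[3]}.
Definition vx : MP3 := 'X_(@Ordinal 3 0 isT).
Definition vz : MP3 := 'X_(@Ordinal 3 1 isT).
Definition vt : MP3 := 'X_(@Ordinal 3 2 isT).

Definition Qstep (m : nat) (P : {poly MP3}) : {poly MP3} :=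
  (vx%:P + m%:R * vz%:P) * P + ('X + vt%:P) * (m%:R * P + 'X * P^`()).

(* Qaux m = Q_{m+1} *)
Fixpoint Qaux (m : nat) : {poly MP3} :=
  match m with
  | 0 => 1
  | m'.+1 => Qstep m'.+1 (Qaux m')
  end.

(* Q n = Q_n  (meaningful for n >= 1) *)
Definition Q (n : nat) : {poly MP3} := Qaux n.-1.

Notation MP2 := {mpoly int[2]}.
Definition ux : MP2 := 'X_(@Ordinal 2 0 isT).
Definition ut : MP2 := 'X_(@Ordinal 2 1 isT).

Definition Qnk (n k : nat) : MP2 :=
  (map_poly (fun c : MP3 => c \mPo [tuple ux; 1; ut]) (Q n))`_k.

(* ---------- Plane trees on [n] ------------------------------------------
   The vertex labelled i+1 is represented by the ordinal i : 'I_n (this is an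
   order-preserving relabelling).  A plane tree is encoded by
   T : {ffun 'I_n -> option ('I_n * 'I_n)} where T w = None iff w is the root
   and T w = Some (p, i) iff w is a child of p and is at position i
   (0 = leftmost) in the left-to-right order of the children of p. *)

Section PlaneTrees.
Variable n : nat.
Definition ptree := {ffun 'I_n -> option ('I_n * 'I_n)}.
Implicit Types (T : ptree) (v w : 'I_n).

Definition prel T : rel 'I_n :=
  fun w u => if T w is Some (p, _) then p == u else false.

Definition isChild T v w : bool := prel T w v.

Definition pos T w : nat := if T w is Some (_, i) then val i else 0.

Definition deg T v : nat := #|[set w | isChild T v w]|.

(* validity: exactly one root, positions of the children of each vertex are
   exactly 0, ..., deg - 1, and every vertex reaches the root via parents *)
Definition is_plane_tree T : bool :=
  [&& #|[set r | T r == None]| == 1%N,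
      [forall v, forall w, isChild T v w ==> (pos T w < deg T v)%N],
      [forall v, forall w1, forall w2,
         [&& isChild T v w1, isChild T v w2 & pos T w1 == pos T w2] ==> (w1 == w2)]
    & [forall w, exists r, (T r == None) && connect (prel T) w r]].

Definition desc T v w : bool := connect (prel T) w v.

Definition beta T v : nat := \big[minn/n]_(w | desc T v w) val w.

Definition elder T j : bool :=
  [exists k, [exists p, isChild T p j && isChild T p k]
               && (pos T j < pos T k)%N && (beta T k < beta T j)%N].

Definition eldv T v : nat := #|[set w | isChild T v w & elder T w]|.
Definition youngv T v : nat := (deg T v - eldv T v)%N.
Definition eld T : nat := #|[set w | elder T w]|.

(* young_T at the vertex whose ordinal value is a (i.e. label a+1) *)
Definition youngAt T (a : nat) : nat :=
  #|[set w | (if T w is Some (p, _) then val p == a else false) && ~~ elder T w]|.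

Definition proper T (i j : 'I_n) : bool := elder T j || (val i < beta T j)%N.

Definition nimproper T : nat :=
  #|[set e : 'I_n * 'I_n | isChild T e.1 e.2 && ~~ proper T e.1 e.2]|.

Definition Pset (k : nat) : {set ptree} :=
  [set T : ptree | is_plane_tree T & nimproper T == k].
End PlaneTrees.

(* Main.v *)
Require Import Defs.
From mathcomp Require Import all_boot all_order all_fingroup all_algebra.
From mathcomp Require Import zify ring.
From mathcomp Require Import mpoly.
Set Implicit Arguments.
Unset Strict Implicit.
Unset Printing Implicit Defensive.
Import GRing.Theory.

(** Weigh a plane tree by [x ^ young(1) * t ^ eld * y ^ (improper edges)] and
    consider the trees on a vertex set [A] all of whose [beta]'s are below a
    threshold [m].  Raising the threshold past [m \in A] adds the trees whose
    largest leaf is [m].  If the parent [v] of that leaf satisfies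
    [beta v < m], deleting the leaf changes no other [beta], and summing over
    the [deg v + 1] possible positions of [m] below [v] gives the factor
    [t * deg v + (x, 1 or y)]; otherwise [m] is the only child of [v > m], and
    contracting [v] into [m] loses a factor [y].  The resulting recursion only
    involves the number [i] of labels above the threshold and the number [j]
    below it.  With [i] recorded by an exponential variable [s] and
    [w = 1 / (1 - y s)], the weight sums for fixed [j] become a polynomial in
    [w], which is [w ^ j] times [Q_j(x - t - 1, y, 1, t)] with [(y + t) w - t]
    substituted for [y]; the theorem is the value at [s = 0]. *)

(** * Reachability along a relation *)

Section Connect.
Variables (V : finType).
Implicit Types (e : rel V) (S : pred V).

Lemma connect_invariant e S a b :
  (forall u v, S u -> e u v -> S v) -> S a -> connect e a b -> S b.
Proof.
move=> Scl Sa /connectP[p ep ->]; elim: p a Sa ep => //= c p IHp a Sa.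
by case/andP=> eac; apply: IHp; apply: Scl eac.
Qed.

(** Meant for parent relations that agree off a leaf: a path starting elsewhere never enters the
    leaf, so it is the same in both. *)
Lemma eq_connect_in e e' S a b :
    (forall u, S u -> e u =1 e' u) -> (forall u v, S u -> e u v -> S v) ->
  S a -> connect e a b = connect e' a b.
Proof.
move=> ee' Scl Sa.
suff sub (f g : rel V) : (forall u, S u -> f u =1 g u) ->
    (forall u v, S u -> f u v -> S v) -> connect f a b -> connect g a b.
  apply/idP/idP; apply: sub => // u; first by move=> Su v; rewrite ee'.
  by move=> v Su; rewrite -ee' //; apply: Scl.
move=> fg fcl /connectP[p fp ->]; elim: p a Sa fp => //= c p IHp d Sd.
case/andP=> fdc fp; apply: connect_trans (IHp c (fcl _ _ Sd fdc) fp).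
by apply: connect1; rewrite -fg.
Qed.

Lemma connect_step e a b :
  connect e a b = (a == b) || [exists c, e a c && connect e c b].
Proof.
apply/idP/orP => [/connectP[[|c p] /= ep ->]|[/eqP->|/existsP[c /andP[ac cb]]]].
- by left.
- by right; apply/existsP; exists c; case/andP: ep => -> ?; apply/connectP; exists p.
- exact: connect0.
- exact: connect_trans (connect1 ac) cb.
Qed.

End Connect.

(** * Plane trees on a subset of the labels *)

Section PlaneTreeBasics.
Variable n : nat.
Implicit Types (T : ptree n) (u v w m : 'I_n) (A : {set 'I_n}).

Definition parent T w := if T w is Some (p, _) then p else w.

Lemma prelP T w u : reflect (exists i, T w = Some (u, i)) (prel T w u).
Proof.
rewrite /prel; case: (T w) => [[p i]|]; last by constructor=> -[].
by apply: (iffP eqP) => [->|[j [->]]] //; exists i.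
Qed.

Lemma prel_some T w p i u : T w = Some (p, i) -> prel T w u = (p == u).
Proof. by rewrite /prel => ->. Qed.

Lemma prel_none T w u : T w = None -> prel T w u = false.
Proof. by rewrite /prel => ->. Qed.

Lemma desc_some T w p i u : T w = Some (p, i) -> desc T u w = (w == u) || desc T u p.
Proof.
move=> Tw; rewrite /desc connect_step; congr (_ || _).
apply/existsP/idP => [[c]|pu]; first by rewrite (prel_some _ Tw) => /andP[/eqP->].
by exists p; rewrite (prel_some _ Tw) eqxx.
Qed.

Lemma desc_none T w u : T w = None -> desc T u w = (w == u).
Proof.
move=> Tw; rewrite /desc connect_step orbC.
by case: existsP => // -[c]; rewrite (prel_none _ Tw).
Qed.

Lemma desc_refl T v : desc T v v. Proof. exact: connect0. Qed.

Lemma desc_trans T u v w : desc T u v -> desc T v w -> desc T u w.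
Proof. by move=> uv vw; apply: connect_trans vw uv. Qed.

Lemma beta_le T v w : desc T v w -> beta T v <= w.
Proof.
move=> vw; rewrite /beta; have: w \in index_enum 'I_n by exact: mem_index_enum.
elim: (index_enum _) => //= u s IHs; rewrite inE big_cons => /orP[/eqP<-|/IHs le_s].
  by rewrite vw geq_minl.
by case: ifP => // _; rewrite geq_min le_s orbT.
Qed.

(** Since [v] is its own descendant, the default [n] of the minimum is never its value. *)
Lemma beta_desc T v : exists2 w : 'I_n, desc T v w & beta T v = w.
Proof.
pose P w := desc T v w.
have vP : P v by exact: desc_refl.
case: (arg_minnP (fun w : 'I_n => w : nat) vP) => w vw minw; exists w => //.
apply/eqP; rewrite eqn_leq (beta_le vw) /= /beta.
elim/big_ind: _ => [|a b wa wb|u]; [exact: ltnW | by rewrite leq_min wa | exact: minw].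
Qed.

Lemma beta_geP T v k : reflect (forall w, desc T v w -> k <= w) (k <= beta T v).
Proof.
apply: (iffP idP) => [kb w vw|H]; first exact: leq_trans kb (beta_le vw).
by have [w vw ->] := beta_desc T v; apply: H.
Qed.

Lemma beta_desc_le T v w : desc T v w -> beta T v <= beta T w.
Proof. by move=> vw; apply/beta_geP=> u /(desc_trans vw); apply: beta_le. Qed.

Lemma elderP T j :
  reflect (exists k p i i',
             [/\ T j = Some (p, i), T k = Some (p, i'), i < i' & beta T k < beta T j])
          (elder T j).
Proof.
apply: (iffP existsP) => [[k]|[k [p [i [i' [Tj Tk lt_i bk]]]]]].
  rewrite -andbA /isChild => /and3P[/existsP[p /andP[/prelP[i Tj] /prelP[i' Tk]]]].
  by rewrite /pos Tj Tk => lt_i bk; exists k, p, i, i'.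
exists k; rewrite /pos Tj Tk lt_i bk !andbT; apply/existsP; exists p.
by rewrite /isChild (prel_some _ Tj) (prel_some _ Tk) eqxx.
Qed.

(* Vertices outside [A] are given the value [None], which inside [A] marks the
   root. *)
Definition plane_tree_on A T : bool :=
  [&& [forall w, (w \notin A) ==> (T w == None)],
      [forall w, if T w is Some (p, i) then (p \in A) && (i < deg T p) else true],
      [forall w1, forall w2, (T w1 == T w2) && (T w1 != None) ==> (w1 == w2)]
    & [exists r in A, (T r == None) && [forall w in A, connect (prel T) w r]]].

Lemma plane_tree_onP A T :
  reflect
    [/\ forall w, w \notin A -> T w = None,
        forall w p i, T w = Some (p, i) -> p \in A /\ i < deg T p,
        forall w1 w2 c, T w1 = Some c -> T w2 = Some c -> w1 = w2
      & exists r, [/\ r \in A, T r = None & forall w, w \in A -> desc T r w]]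
    (plane_tree_on A T).
Proof.
apply: (iffP and4P) => -[H1 H2 H3 H4]; split.
- by move=> w wA; apply/eqP; move/forallP/(_ w)/implyP: H1; apply.
- by move=> w p i Tw; move/forallP/(_ w): H2; rewrite Tw => /andP[].
- move=> w1 w2 c T1 T2; apply/eqP.
  by move/forallP/(_ w1)/forallP/(_ w2)/implyP: H3; apply; rewrite T1 T2 eqxx.
- case/existsP: H4 => r /and3P[rA /eqP Tr /forallP rw]; exists r; split=> // w wA.
  exact: (implyP (rw w) wA).
- by apply/forallP=> w; apply/implyP=> /H1->.
- by apply/forallP=> w; case Tw: (T w) => [[p i]|//]; apply/andP; apply: H2 Tw.
- apply/forallP=> w1; apply/forallP=> w2; apply/implyP=> /andP[/eqP T12].
  by case T1: (T w1) => [c|//] _; apply/eqP; apply: (H3 _ _ c); rewrite -?T12.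
- case: H4 => r [rA Tr rw]; apply/existsP; exists r; rewrite rA Tr eqxx /=.
  by apply/forallP=> w; apply/implyP=> /rw.
Qed.

Section OnePlaneTree.
Variables (A : {set 'I_n}) (T : ptree n).
Hypothesis AT : plane_tree_on A T.

Lemma par_in w p i : T w = Some (p, i) -> p \in A.
Proof. by case/plane_tree_onP: AT => _ H _ _ /H[]. Qed.

Lemma pos_lt_deg w p i : T w = Some (p, i) -> i < deg T p.
Proof. by case/plane_tree_onP: AT => _ H _ _ /H[]. Qed.

Lemma vertex_in w p i : T w = Some (p, i) -> w \in A.
Proof. by case/plane_tree_onP: AT => H _ _ _; apply: contra_eqT => /H->. Qed.

Lemma vertex_out w : w \notin A -> T w = None.
Proof. by case/plane_tree_onP: AT => H _ _ _; apply: H. Qed.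

Lemma pos_inj w1 w2 c : T w1 = Some c -> T w2 = Some c -> w1 = w2.
Proof. by case/plane_tree_onP: AT => _ _ H _; apply: H. Qed.

Lemma root_exists : exists r, [/\ r \in A, forall w, w \in A -> (T w == None) = (w == r)
  & forall w, w \in A -> desc T r w].
Proof.
case/plane_tree_onP: AT => _ _ _ [r [rA Tr rw]]; exists r; split=> // w wA.
apply/eqP/eqP => [Tw|->//]; apply/eqP.
by rewrite -(desc_none _ Tw); apply: rw.
Qed.

Lemma desc_in v w : v \in A -> desc T v w -> w \in A.
Proof.
move=> vA vw; apply: contraLR vA => wA.
by move: vw; rewrite (desc_none _ (vertex_out wA)) => /eqP<-.
Qed.

(* On a cycle every parent pointer stays on the cycle, which then misses the root. *)
Lemma par_not_desc w p i : T w = Some (p, i) -> ~~ desc T w p.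
Proof.
move=> Tw; apply/negP=> wp; have [r [rA Tr rw]] := root_exists.
have wr := rw _ (vertex_in Tw).
have : desc T w r && desc T r w.
  pose S u := desc T w u && desc T u w.
  apply: (connect_invariant (S := S)) wr; last by rewrite /S desc_refl.
  move=> u v /andP[wu uw] /prelP[j Tu].
  have vu : desc T v u by rewrite (desc_some _ Tu) desc_refl orbT.
  rewrite /S (desc_trans vu uw) andbT.
  have [uw0|uw0] := eqVneq u w; last by move: wu; rewrite (desc_some _ Tu) (negbTE uw0).
  by move: Tu; rewrite uw0 Tw => -[<- _].
case/andP=> + _; rewrite (desc_none (w := r)); last by apply/eqP; rewrite Tr.
by move/eqP=> rw0; move: (Tr r rA); rewrite rw0 eqxx Tw.
Qed.

Lemma par_neq w p i : T w = Some (p, i) -> w != p.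
Proof. by move/par_not_desc; apply: contraNneq => ->; exact: desc_refl. Qed.

Lemma deg_lt v : v \in A -> deg T v < #|A|.
Proof.
move=> vA; have [r [rA Tr rw]] := root_exists.
rewrite (cardsD1 r A) rA ltnS; apply: subset_leq_card; apply/subsetP=> w.
rewrite !inE /isChild => /prelP[i Tw]; rewrite (vertex_in Tw) andbT.
by rewrite -Tr ?Tw // (vertex_in Tw).
Qed.

(** Pigeonhole: the children of [v] have [deg T v] distinct positions, all below [deg T v]. *)
Lemma pos_onto v (q : nat) : q < deg T v -> exists w i, T w = Some (v, i) /\ val i = q.
Proof.
move=> q_lt; pose C := [set w | isChild T v w].
have inj : {in C &, injective (pos T)}.
  move=> w1 w2; rewrite !inE /isChild => /prelP[i T1] /prelP[j T2].
  by rewrite /pos T1 T2 => /val_inj ij; apply: pos_inj T1 _; rewrite T2 ij.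
have uniq_im : uniq (map (pos T) (enum C)).
  by rewrite map_inj_in_uniq ?enum_uniq // => w1 w2; rewrite !mem_enum; apply: inj.
have sub : {subset map (pos T) (enum C) <= iota 0 (deg T v)}.
  move=> k /mapP[w]; rewrite mem_enum inE /isChild => /prelP[i Tw] ->.
  by rewrite /pos Tw mem_iota; apply: pos_lt_deg Tw.
have [|_ eq_im] := uniq_min_size uniq_im sub.
  by rewrite size_iota size_map -cardE.
have : q \in iota 0 (deg T v) by rewrite mem_iota.
rewrite -eq_im => /mapP[w]; rewrite mem_enum inE /isChild => /prelP[i Tw] ->.
by exists w, i; rewrite /pos Tw.
Qed.

(** Every vertex except the root is counted once, at its parent. *)
Lemma sum_deg : \sum_(v in A) deg T v = #|A|.-1.
Proof.
have [r [rA Tr rw]] := root_exists.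
rewrite (cardsD1 r A) rA add1n /= -sum1_card.
rewrite [RHS](partition_big (fun w => parent T w) (mem A)) /=; last first.
  move=> w; rewrite !inE => /andP[wr wA]; move: (Tr w wA); rewrite (negbTE wr) /parent.
  by case Tw: (T w) => [[p i]|//] _; apply: par_in Tw.
apply: eq_bigr => v vA; rewrite sum1_card; apply: eq_card => w.
rewrite inE /isChild [RHS]unfold_in !inE /parent -andbA.
apply/prelP/and3P => [[i Tw]|[wr wA]].
  by rewrite -Tr ?(vertex_in Tw) // Tw.
move: (Tr w wA); rewrite (negbTE wr).
by case: (T w) => [[p i]|//] _ /eqP<-; exists i.
Qed.

End OnePlaneTree.
End PlaneTreeBasics.

(** * Inserting and deleting a leaf *)

Section LeafInsertion.
Variable n : nat.
Implicit Types (T : ptree n) (u v w m q i : 'I_n) (A B : {set 'I_n}).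

(** At the end of the range [insubd] returns [i] itself; [pos_succ_lt] keeps the shifted positions
    away from this case. *)
Definition ord_up i : 'I_n := insubd i i.+1.
Definition ord_down i : 'I_n := insubd i i.-1.

Lemma val_ord_up i : i.+1 < n -> ord_up i = i.+1 :> nat.
Proof. by move=> lt_i; rewrite /ord_up val_insubd lt_i. Qed.

Lemma val_ord_down i : ord_down i = i.-1 :> nat.
Proof. by rewrite /ord_down val_insubd (leq_ltn_trans (leq_pred i) (ltn_ord i)). Qed.

Definition add_leaf T m v q : ptree n :=
  [ffun w => if w == m then Some (v, q)
             else if T w is Some (p, i)
                  then Some (p, if (p == v) && (q <= i) then ord_up i else i)
                  else None].

Definition del_leaf T m v q : ptree n :=
  [ffun w => if w == m then None
             else if T w is Some (p, i)
                  then Some (p, if (p == v) && (q < i) then ord_down i else i)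
                  else None].

Lemma beta_ltn T w : beta T w < n.
Proof. by have [u _ ->] := beta_desc T w. Qed.

Lemma desc_leaf T w u : (forall a, ~~ prel T a w) -> desc T w u -> u = w.
Proof.
move=> lf wu; apply/eqP; apply: contraT => uw.
suff : predC1 w w by rewrite /= eqxx.
apply: (connect_invariant (S := predC1 w)) uw wu => a b _ ab.
by apply: contraTneq ab => ->; apply: lf.
Qed.

Lemma leaf_beta T w : (forall u, ~~ prel T u w) -> beta T w = w.
Proof.
by move=> lf; have [u wu ->] := beta_desc T w; rewrite (desc_leaf lf wu).
Qed.

Section Extension.
Variables (T T' : ptree n) (m v : 'I_n).
Hypothesis agree : forall w, w != m -> prel T w =1 prel T' w.
Hypothesis leaf : forall w, ~~ prel T w m.
Hypothesis Tm : exists q, T m = Some (v, q).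
Hypothesis T'm : T' m = None.

(** Only parents are assumed to agree, not positions, so this serves both insertion and deletion. As
    [m] is a leaf of [T], paths from other vertices avoid it. *)
Lemma desc_ext u w : w != m -> desc T u w = desc T' u w.
Proof.
move=> wm; apply: (eq_connect_in (S := predC1 m)) wm => // a b _ ab.
by apply: contraTneq ab => ->; apply: leaf.
Qed.

(** The only possible new descendant is [m], which cannot lower a minimum that is at most [m]
    already. *)
Lemma beta_ext u :
  u != m -> (desc T u m -> beta T' u <= m) -> beta T u = beta T' u.
Proof.
move=> um bu; apply/eqP; rewrite eqn_leq; apply/andP; split.
  have [w uw ->] := beta_desc T' u.
  have [wm|wm] := eqVneq w m; last by apply: beta_le; rewrite desc_ext.
  by move: uw; rewrite wm (desc_none _ T'm) => /eqP mu; rewrite mu eqxx in um.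
have [w uw ->] := beta_desc T u.
have [wm|wm] := eqVneq w m; first by rewrite wm; apply: bu; rewrite -wm.
by apply: beta_le; rewrite -desc_ext.
Qed.

Lemma deg_ext p : deg T p = deg T' p + (v == p).
Proof.
rewrite /deg (cardsD1 m) addnC inE /isChild; case: Tm => q Tm'.
rewrite (prel_some _ Tm'); congr (_ + _); apply: eq_card => w.
rewrite !inE /isChild; have [->|wm] /= := eqVneq w m.
  by rewrite (prel_none _ T'm).
exact: agree.
Qed.

End Extension.

Lemma parent_some T w p i : T w = Some (p, i) -> parent T w = p.
Proof. by rewrite /parent => ->. Qed.

Section Add.
Variables (A : {set 'I_n}) (T' : ptree n) (m v q : 'I_n).
Hypothesis mA : m \in A.
Hypothesis BT' : plane_tree_on (A :\ m) T'.
Hypothesis vB : v \in A :\ m.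
Hypothesis q_le : q <= deg T' v.
Let T := add_leaf T' m v q.

Lemma add_leaf_m : T m = Some (v, q).
Proof. by rewrite ffunE eqxx. Qed.

Lemma add_leaf_neq w : w != m ->
  T w = if T' w is Some (p, i)
        then Some (p, if (p == v) && (q <= i) then ord_up i else i) else None.
Proof. by rewrite ffunE => /negbTE->. Qed.

Lemma removed_none : T' m = None.
Proof. by apply: (vertex_out BT'); rewrite !inE eqxx. Qed.

Lemma par_neq_m : v != m.
Proof. by move: vB; rewrite !inE => /andP[]. Qed.

Lemma add_leaf_prel w : w != m -> prel T w =1 prel T' w.
Proof. by move=> wm u; rewrite /prel add_leaf_neq //; case: (T' w) => [[]|]. Qed.

Lemma add_leaf_leaf w : ~~ prel T w m.
Proof.
have [->|wm] := eqVneq w m; first by rewrite (prel_some _ add_leaf_m) par_neq_m.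
rewrite add_leaf_prel //; apply/negP=> /prelP[i /(par_in BT')].
by rewrite !inE eqxx.
Qed.

(** A degree is smaller than the number of vertices, hence smaller than [n]. *)
Lemma pos_succ_lt w p i : T' w = Some (p, i) -> i.+1 < n.
Proof.
move=> Tw; apply: leq_ltn_trans (pos_lt_deg BT' Tw) _.
apply: leq_trans (deg_lt BT' (par_in BT' Tw)) _.
by rewrite -[X in _ <= X]card_ord max_card.
Qed.

Lemma add_leafP w p k : w != m -> T w = Some (p, k) ->
  exists2 i : 'I_n, T' w = Some (p, i) & k = i + ((p == v) && (q <= i)) :> nat.
Proof.
move=> wm; rewrite add_leaf_neq //; case Tw: (T' w) => [[p' i]|//] [<- <-].
exists i => //; case: ifP => _; last by rewrite addn0.
by rewrite val_ord_up ?addn1 ?(pos_succ_lt Tw).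
Qed.

Lemma add_leaf_some w p i : w != m -> T' w = Some (p, i) ->
  exists2 k : 'I_n, T w = Some (p, k) & k = i + ((p == v) && (q <= i)) :> nat.
Proof.
move=> wm Tw; rewrite add_leaf_neq // Tw.
exists (if (p == v) && (q <= i) then ord_up i else i) => //.
case: ifP => _; last by rewrite addn0.
by rewrite val_ord_up ?addn1 ?(pos_succ_lt Tw).
Qed.

Lemma add_leaf_plane : plane_tree_on A T.
Proof.
have Tm := add_leaf_m; have Tq : exists q, T m = Some (v, q) by exists q.
have dT := deg_ext add_leaf_prel Tq removed_none.
apply/plane_tree_onP; split.
- move=> w wA; have wm : w != m by apply: contraNneq wA => ->.
  by rewrite add_leaf_neq // (vertex_out BT') // !inE (negbTE wA) andbF.
- move=> w p k; have [->|wm] := eqVneq w m.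
    rewrite Tm => -[<- <-]; rewrite dT eqxx addn1 ltnS q_le; split=> //.
    by move: vB; rewrite !inE => /andP[].
  case/add_leafP=> // i Tw ->; split.
    by have := par_in BT' Tw; rewrite !inE => /andP[].
  by have := pos_lt_deg BT' Tw; rewrite dT (eq_sym v); lia.
- move=> w1 w2 [p k]; have [->|w1m] := eqVneq w1 m.
    have [->//|w2m] := eqVneq w2 m.
    rewrite Tm => -[<- <-] /add_leafP[] // i _; rewrite eqxx => e; exfalso; lia.
  case/add_leafP=> // i1 T1 e1; have [->|w2m] := eqVneq w2 m.
    by rewrite Tm => -[pv qk]; move: e1; rewrite -pv -qk eqxx => e; exfalso; lia.
  case/add_leafP=> // i2 T2 e2; apply: (pos_inj BT') T1 _; rewrite T2.
  by congr (Some (_, _)); apply: val_inj => /=; lia.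
- have [r [rB Tr rw]] := root_exists BT'.
  have rm : r != m by move: rB; rewrite !inE => /andP[].
  have Tr0 : T' r = None by apply/eqP; rewrite Tr.
  exists r; split; first by move: rB; rewrite !inE => /andP[].
    by rewrite add_leaf_neq // Tr0.
  move=> w wA; have [->|wm] := eqVneq w m.
    rewrite (desc_some _ Tm) (desc_ext add_leaf_prel add_leaf_leaf) ?par_neq_m //.
    by rewrite rw ?orbT.
  by rewrite (desc_ext add_leaf_prel add_leaf_leaf) // rw // !inE wm.
Qed.

Lemma del_add_leaf : del_leaf T m v q = T'.
Proof.
apply/ffunP=> w; rewrite ffunE; case: eqVneq => [->|wm]; first by rewrite removed_none.
rewrite add_leaf_neq //; case Tw: (T' w) => [[p i]|//]; congr (Some (_, _)).
have lt_i := pos_succ_lt Tw.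
apply: val_inj => /=; case: (p == v) => //=; case: (leqP q i) => qi.
  by rewrite val_ord_up // ltnS qi val_ord_down val_ord_up.
by rewrite ltnNge (ltnW qi).
Qed.

Hypothesis bT' : forall w, w \in A :\ m -> beta T' w < m.

Lemma add_leaf_beta w : w \in A :\ m -> beta T w = beta T' w.
Proof.
move=> wB; apply: (beta_ext add_leaf_prel add_leaf_leaf removed_none).
  by move: wB; rewrite !inE => /andP[].
by move=> _; apply/ltnW/bT'.
Qed.

Lemma add_leaf_beta_m : beta T m = m.
Proof. by apply: leaf_beta => u; apply: add_leaf_leaf. Qed.

(** The new leaf has the largest [beta], so it makes no brother elder, and the old brothers keep
    their relative order. *)
Lemma add_leaf_elder w : w \in A :\ m -> elder T w = elder T' w.
Proof.
move=> wB; have wm : w != m by move: wB; rewrite !inE => /andP[].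
apply/elderP/elderP => -[k [p [i [i' [Tw Tk lt_i bk]]]]].
  have km : k != m.
    apply: contraTneq bk => ->; rewrite add_leaf_beta_m add_leaf_beta //.
    by rewrite -leqNgt ltnW // bT'.
  have [j Tw' ej] := add_leafP wm Tw; have [j' Tk' ej'] := add_leafP km Tk.
  exists k, p, j, j'; split=> //; first lia.
  by rewrite -!add_leaf_beta // (vertex_in BT' Tk').
have kB := vertex_in BT' Tk; have km : k != m by move: kB; rewrite !inE => /andP[].
have [j Tw' ej] := add_leaf_some wm Tw; have [j' Tk' ej'] := add_leaf_some km Tk.
exists k, p, j, j'; split=> //; first lia.
by rewrite !add_leaf_beta.
Qed.

(** Every brother of [m] has a smaller [beta], so [m] is younger only in the rightmost position. *)
Lemma add_leaf_elder_m : elder T m = (q < deg T' v).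
Proof.
apply/elderP/idP => [[k [p [i [i' [Tm Tk lt_i bk]]]]]|lt_q].
  have km : k != m by apply: contraTneq bk => ->; rewrite ltnn.
  move: Tm lt_i; rewrite add_leaf_m => -[-> ->]; have [j Tk' ej] := add_leafP km Tk.
  by have := pos_lt_deg BT' Tk'; rewrite {}ej; lia.
have [k [i [Tk iq]]] := pos_onto BT' lt_q.
have kB := vertex_in BT' Tk; have km : k != m by move: kB; rewrite !inE => /andP[].
have [j Tk' ej] := add_leaf_some km Tk.
exists k, v, q, j; split; rewrite ?add_leaf_m //; first by rewrite ej -iq /= eqxx; lia.
by rewrite add_leaf_beta_m add_leaf_beta // bT'.
Qed.

End Add.

Section Del.
Variables (A : {set 'I_n}) (T : ptree n) (m v q : 'I_n).
Hypothesis AT : plane_tree_on A T.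
Hypothesis leaf : forall w, ~~ prel T w m.
Hypothesis Tm : T m = Some (v, q).
Let T' := del_leaf T m v q.

Lemma del_leaf_m : T' m = None.
Proof. by rewrite ffunE eqxx. Qed.

Lemma del_leaf_prel w : w != m -> prel T w =1 prel T' w.
Proof.
by move=> wm u; rewrite /prel ffunE (negbTE wm); case: (T w) => [[]|].
Qed.

Lemma del_leaf_pos_neq w i : w != m -> T w = Some (v, i) -> i != q :> nat.
Proof.
move=> wm Tw; apply: contraNneq wm => /val_inj iq.
by apply/eqP; apply: (pos_inj AT Tw); rewrite Tm iq.
Qed.

Lemma del_leafP w p k : T' w = Some (p, k) -> exists i : 'I_n,
  [/\ w != m, T w = Some (p, i) & k = i - ((p == v) && (q < i)) :> nat].
Proof.
rewrite ffunE; case: eqVneq => // wm; case Tw: (T w) => [[p' i]|//] [<- <-].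
exists i; split=> //; case: ifP => _; last by rewrite subn0.
by rewrite val_ord_down subn1.
Qed.

Lemma del_leaf_plane : plane_tree_on (A :\ m) T'.
Proof.
have Tq : exists q, T m = Some (v, q) by exists q.
have dT := deg_ext del_leaf_prel Tq del_leaf_m.
have mv : v != m by move: (leaf m); rewrite (prel_some _ Tm).
apply/plane_tree_onP; split.
- move=> w; rewrite !inE negb_and negbK => /orP[/eqP->|wA]; first exact: del_leaf_m.
  by rewrite ffunE; case: ifP => // _; rewrite (vertex_out AT).
- move=> w p k /del_leafP[i [wm Tw ->]]; split.
    rewrite !inE (par_in AT Tw) andbT.
    by move: (leaf w); rewrite (prel_some _ Tw).
  have := pos_lt_deg AT Tw; rewrite dT; have := pos_lt_deg AT Tm; rewrite dT eqxx.
  have [pv|pv] := eqVneq p v; last by lia.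
  by move: Tw; rewrite pv => /(del_leaf_pos_neq wm); lia.
- move=> w1 w2 [p k] /del_leafP[i1 [w1m T1 e1]] /del_leafP[i2 [w2m T2 e2]].
  apply: (pos_inj AT T1); rewrite T2; congr (Some (_, _)); apply: val_inj => /=.
  have [pv|pv] := eqVneq p v; last by move: e1 e2; rewrite ?(negbTE pv); lia.
  rewrite pv in T1 T2.
  have := del_leaf_pos_neq w1m T1; have := del_leaf_pos_neq w2m T2; lia.
- have [r [rA Tr rw]] := root_exists AT; have Tr0 : T r = None by apply/eqP; rewrite Tr.
  have rm : r != m by apply: contra_eqN Tr0 => /eqP->; rewrite Tm.
  exists r; split; [by rewrite !inE rm | by rewrite ffunE (negbTE rm) Tr0 |].
  move=> w; rewrite !inE => /andP[wm wA].
  by rewrite -(desc_ext del_leaf_prel leaf) // rw.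
Qed.

(** No other child of [v] sits at position [q], so closing the gap loses no information. *)
Lemma add_del_leaf : add_leaf T' m v q = T.
Proof.
apply/ffunP=> w; rewrite ffunE; case: eqVneq => [->//|wm].
rewrite ffunE (negbTE wm); case Tw: (T w) => [[p i]|//]; congr (Some (_, _)).
have [pv|pv] //= := eqVneq p v; rewrite pv in Tw.
have iq := del_leaf_pos_neq wm Tw.
case: (ltnP q i) => qi; last by rewrite leqNgt ltn_neqAle iq qi.
apply: val_inj; rewrite /= val_ord_down.
have -> : q <= i.-1 by lia.
by rewrite val_ord_up val_ord_down; have := ltn_ord i; lia.
Qed.

Lemma del_leaf_pos : q <= deg T' v.
Proof.
have Tq : exists q, T m = Some (v, q) by exists q.
have := pos_lt_deg AT Tm; rewrite (deg_ext del_leaf_prel Tq del_leaf_m) eqxx; lia.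
Qed.

Lemma del_leaf_par : v \in A :\ m.
Proof.
by rewrite !inE (par_in AT Tm) andbT; move: (leaf m); rewrite (prel_some _ Tm).
Qed.

Hypothesis bT : forall w, w \in A -> beta T w <= m.
Hypothesis bv : beta T v < m.

(** If [beta T w] were [m], then [w] would lie above [m], hence above [v], and [beta T w] would be
    at most [beta T v < m]. So the minimum is attained away from [m] and survives the deletion. *)
Lemma del_leaf_beta w : w \in A :\ m -> beta T' w < m.
Proof.
rewrite !inE => /andP[wm wA].
have bwm : beta T w < m.
  rewrite ltn_neqAle bT // andbT; apply: contraTneq (bv) => bw.
  have [u wu bu] := beta_desc T w; rewrite bw in bu.
  move: wu; rewrite -(val_inj bu) (desc_some _ Tm) eq_sym (negbTE wm) /= => wv.
  by rewrite -leqNgt -bw; apply: beta_desc_le.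
have [u wu bu] := beta_desc T w; rewrite bu in bwm.
apply: leq_ltn_trans (bwm); apply: beta_le; rewrite -(desc_ext del_leaf_prel leaf) //.
by apply: contraTneq bwm => ->; rewrite ltnn.
Qed.

End Del.
End LeafInsertion.

(** * Contracting the parent of a leaf *)

Section Contraction.
Variable n : nat.
Implicit Types (T : ptree n) (u v w m q i : 'I_n) (A B : {set 'I_n}).

Definition ord_zero m : 'I_n := Ordinal (leq_ltn_trans (leq0n m) (ltn_ord m)).

(** Only the argument of [T] is transposed. Where this is used, neither [m] nor [v] is a parent in
    the smaller tree, so the parent pointers need no renaming. *)
Definition expand_leaf T m v : ptree n :=
  [ffun w => if w == m then Some (v, ord_zero m) else T (tperm m v w)].

Definition contract_leaf T m v : ptree n :=
  [ffun w => if w == v then None else T (tperm m v w)].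

(* [T] arises from [T0] by renaming the leaf [m] to [v] and hanging [m] below
   [v]; away from [m] the two trees correspond under the transposition. *)
Section Exchange.
Variables (T T0 : ptree n) (m v : 'I_n).
Hypothesis lt_mv : m < v.
Hypothesis exch : forall w, w != m -> T w = T0 (tperm m v w).
Hypothesis T0_par : forall w p i, T0 w = Some (p, i) -> p != m /\ p != v.
Hypothesis Tm : T m = Some (v, ord_zero m).
Hypothesis T0v : T0 v = None.

Lemma neq_vm : v != m. Proof. by apply: contraTneq lt_mv => ->; rewrite ltnn. Qed.
Hint Resolve neq_vm : core.

Lemma tperm_neq w : w != m -> tperm m v w != v.
Proof. by apply: contraNneq => /(canRL (tpermK m v)) ->; rewrite tpermR. Qed.

Lemma exch_par w p i : w != m -> T w = Some (p, i) -> p != m /\ p != v.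
Proof. by move=> wm; rewrite exch //; apply: T0_par. Qed.

Lemma exch_leaf w : ~~ prel T w m.
Proof.
have [->|wm] := eqVneq w m; first by rewrite (prel_some _ Tm).
by apply/negP=> /prelP[i /(exch_par wm)[]]; rewrite eqxx.
Qed.

Lemma exch_only_child w i : T w = Some (v, i) -> w = m.
Proof.
by move=> Tw; apply: contra_eq Tw => wm; apply/eqP => /(exch_par wm)[_]; rewrite eqxx.
Qed.

Lemma exch_deg_v : deg T v = 1.
Proof.
rewrite /deg -(cards1 m); apply: eq_card => w; rewrite !inE /isChild.
apply/prelP/eqP => [[i]|->]; [exact: exch_only_child | by eexists; apply: Tm].
Qed.

Lemma exch_prel w p : w != m -> prel T w p = prel T0 (tperm m v w) p.
Proof. by move=> wm; rewrite /prel exch. Qed.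

Lemma exch_prel_perm w p :
  w != m -> prel T w p = prel T0 (tperm m v w) (tperm m v p).
Proof.
move=> wm; rewrite exch_prel //; case: (tpermP m v p) => [->|->|//]; apply/idP/idP;
  by move=> /prelP[i /T0_par[]]; rewrite eqxx.
Qed.

Lemma exch_deg p : p != v -> deg T p = deg T0 p.
Proof.
move=> pv; rewrite /deg -(card_imset [set w | isChild T p w] (@perm_inj _ (tperm m v))).
apply: eq_card => w; rewrite -[w](tpermK m v) mem_imset; last exact: perm_inj.
rewrite !inE tpermK /isChild; set w' := tperm m v w.
have -> : w = tperm m v w' by rewrite tpermK.
have [->|wm] := eqVneq w' m; last exact: exch_prel.
by rewrite tpermL (prel_some _ Tm) (prel_none _ T0v) eq_sym (negbTE pv).
Qed.

Lemma exch_desc u w : w != m -> desc T u w = desc T0 (tperm m v u) (tperm m v w).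
Proof.
move=> wm; rewrite /desc.
(* Off [m], the parent relation of [T] is that of [T0] conjugated by the transposition, so paths can
   be mapped through it. *)
rewrite (eq_connect_in (e' := relpre (tperm m v) (prel T0)) (S := predC1 m)) //.
- apply/connectP/connectP => -[p pP def_u].
    by exists (map (tperm m v) p); rewrite ?def_u ?last_map // path_map.
  exists (map (tperm m v) p); last first.
    by rewrite -[w](tpermK m v) last_map -def_u tpermK.
  rewrite -[w](tpermK m v) path_map; apply: sub_path pP => a b.
  by rewrite /= !tpermK.
- by move=> a am b; apply: exch_prel_perm.
- by move=> a b _ ab; apply: contraTneq ab => ->; apply: exch_leaf.
Qed.

Lemma exch_desc_m u : u != m -> desc T u m = desc T0 (tperm m v u) m.
Proof.
move=> um; rewrite (desc_some _ Tm) eq_sym (negbTE um) /=.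
by rewrite exch_desc // tpermR.
Qed.

(** Where [T0] has the leaf [m], [T] has [v] with [m] below it. As [m < v], the extra descendant [v]
    never decides a minimum. *)
Lemma exch_beta u : u != m -> beta T u = beta T0 (tperm m v u).
Proof.
move=> um; apply/eqP; rewrite eqn_leq; apply/andP; split.
  have [w uw ->] := beta_desc T0 (tperm m v u).
  have [wm|wm] := eqVneq w m.
    by move: uw; rewrite wm => uw; apply: beta_le; rewrite exch_desc_m.
  have wv : w != v.
    apply: contraTneq uw => ->; rewrite (desc_none _ T0v) eq_sym.
    exact: tperm_neq.
  by apply: beta_le; rewrite exch_desc // [tperm m v w]tpermD // eq_sym.
have [w uw ->] := beta_desc T u.
have [wm|wm] := eqVneq w m.
  by move: uw; rewrite wm => uw; apply: beta_le; rewrite -exch_desc_m.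
have [wv|wv] := eqVneq w v.
  move: uw; rewrite wv => uw; apply: leq_trans (ltnW lt_mv); apply: beta_le.
  by rewrite -exch_desc_m // (desc_some _ Tm) uw orbT.
by apply: beta_le; move: uw; rewrite exch_desc // [tperm m v w]tpermD // eq_sym.
Qed.

Lemma exch_beta_m : beta T m = m.
Proof. by apply: leaf_beta => u; apply: exch_leaf. Qed.

(** In [T] the leaf [m] is an only child, hence nobody's brother; all other brothers are transposed
    with their positions and values of [beta]. *)
Lemma exch_elder w : w != m -> elder T w = elder T0 (tperm m v w).
Proof.
move=> wm; apply/elderP/elderP => -[k [p [i [i' [Tw Tk lt_i bk]]]]].
  have km : k != m.
    apply/eqP => km; move: Tk; rewrite km Tm => -[vp _].
    by have [_] := exch_par wm Tw; rewrite vp eqxx.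
  by exists (tperm m v k), p, i, i'; rewrite -!exch // -!exch_beta.
have km : tperm m v k != m.
  by apply/eqP => /(canRL (tpermK m v)) km; move: Tk; rewrite km tpermL T0v.
exists (tperm m v k), p, i, i'; split=> //; rewrite ?exch ?tpermK //.
by rewrite !exch_beta // tpermK.
Qed.

Lemma exch_elder_m : ~~ elder T m.
Proof.
apply/elderP => -[k [p [i [i' [+ + _]]]]]; rewrite Tm => -[<- _] /exch_only_child->.
by rewrite ltnn.
Qed.

Variable A : {set 'I_n}.
Hypotheses (mA : m \in A) (vA : v \in A).

Lemma tperm_in w : (tperm m v w \in A) = (w \in A).
Proof. by case: tpermP => [->|->|//]; rewrite mA vA. Qed.

Lemma tperm_neq_m w : w != v -> tperm m v w != m.
Proof. by apply: contraNneq => /(canRL (tpermK m v)) ->; rewrite tpermL. Qed.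

Lemma exch_sym w : w != v -> T0 w = T (tperm m v w).
Proof. by move=> wv; rewrite exch ?tpermK // tperm_neq_m. Qed.

Lemma exch_plane : plane_tree_on (A :\ v) T0 = plane_tree_on A T.
Proof.
apply/idP/idP => PT; apply/plane_tree_onP; split.
- move=> w wA; have wm : w != m by apply: contraNneq wA => ->.
  by rewrite exch // (vertex_out PT) // !inE tperm_in (negbTE wA) andbF.
- move=> w p i; have [->|wm] := eqVneq w m.
    by rewrite Tm => -[<- <-]; rewrite exch_deg_v.
  move=> Tw; have [_ pv] := exch_par wm Tw; move: Tw; rewrite exch // => Tw.
  rewrite exch_deg // (pos_lt_deg PT Tw); split=> //.
  by have := par_in PT Tw; rewrite !inE => /andP[].
- move=> w1 w2 [p i] T1 T2; have [pv|pv] := eqVneq p v.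
    by move: T1 T2; rewrite pv => /exch_only_child-> /exch_only_child->.
  have wm w : T w = Some (p, i) -> w != m.
    by move=> Tw; apply: contraNneq pv => wm; move: Tw; rewrite wm Tm => -[->].
  apply: (@perm_inj _ (tperm m v)); apply: (pos_inj PT (c := (p, i))).
    by rewrite -exch // wm.
  by rewrite -exch // wm.
- have [r [rB Tr rw]] := root_exists PT; have Tr0 : T0 r = None by apply/eqP; rewrite Tr.
  have [rv rA] : r != v /\ r \in A by move: rB; rewrite !inE => /andP[].
  have rm := tperm_neq_m rv.
  exists (tperm m v r); rewrite tperm_in rA exch // tpermK; split=> // w wA.
  have [->|wm] := eqVneq w m.
    by rewrite exch_desc_m // tpermK rw // !inE eq_sym neq_vm.
  by rewrite exch_desc // tpermK rw // !inE tperm_neq // tperm_in.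
- move=> w; rewrite !inE; have [->//|wv] := eqVneq w v.
  by move=> wA; rewrite exch_sym // (vertex_out PT) // tperm_in.
- move=> w p i Tw; have wv : w != v by apply/eqP=> wv; move: Tw; rewrite wv T0v.
  have [_ pv] := T0_par Tw; rewrite exch_sym // in Tw.
  by rewrite -exch_deg // (pos_lt_deg PT Tw) !inE pv (par_in PT Tw).
- move=> w1 w2 c T1 T2.
  have wv w : T0 w = Some c -> w != v by move=> Tw; apply/eqP=> wv; rewrite wv T0v in Tw.
  apply: (@perm_inj _ (tperm m v)); apply: (pos_inj PT (c := c)).
    by rewrite -exch_sym // wv.
  by rewrite -exch_sym // wv.
- have [r [rA Tr rw]] := root_exists PT; have Tr0 : T r = None by apply/eqP; rewrite Tr.
  have rm : r != m by apply/eqP=> rm; move: Tr0; rewrite rm Tm.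
  exists (tperm m v r); rewrite !inE tperm_neq // tperm_in rA -exch //; split=> // w.
  rewrite !inE => /andP[wv wA]; rewrite -[w](tpermK m v) -exch_desc ?tperm_neq_m //.
  by rewrite rw // tperm_in.
Qed.

End Exchange.
End Contraction.

(** * Trees with a given largest leaf *)

Section LargestLeaf.
Variable n : nat.
Implicit Types (T : ptree n) (u v w m q i : 'I_n) (A B : {set 'I_n}).

Definition below A (k : nat) T := plane_tree_on A T && [forall w in A, beta T w < k].

(* The largest value of [beta] is the largest leaf, so this says that [m] is the
   largest leaf of [T]. *)
Definition largest_leaf A m T := below A m.+1 T && (beta T m == m).

Lemma belowP A k T :
  reflect (plane_tree_on A T /\ forall w, w \in A -> beta T w < k) (below A k T).
Proof.
apply: (iffP andP) => -[AT bT]; split=> //.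
  by move=> w wA; apply: (implyP (forallP bT w)).
by apply/forallP=> w; apply/implyP=> /bT.
Qed.

Lemma largest_leafP A m T :
  reflect [/\ plane_tree_on A T, forall w, w \in A -> beta T w <= m & beta T m = m]
          (largest_leaf A m T).
Proof.
apply: (iffP andP) => [[/belowP[AT bT] /eqP bm]|[AT bT bm]]; split=> //.
  exact/belowP.
exact/eqP.
Qed.

Section Facts.
Variables (A : {set 'I_n}) (m : 'I_n) (T : ptree n).
Hypothesis lT : largest_leaf A m T.

(** A child of [m] would have [beta] both at least and at most [m], so [m] would be a descendant of
    its own child. *)
Lemma largest_leaf_leaf w : ~~ prel T w m.
Proof.
have [AT bT bm] := largest_leafP _ _ _ lT.
apply/negP=> /prelP[i Tw].
have mw : desc T m w by rewrite (desc_some _ Tw) desc_refl orbT.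
have [u wu bu] := beta_desc T w.
have um : u = m.
  apply: val_inj; rewrite /= -bu; apply/eqP; rewrite eqn_leq bT ?(vertex_in AT Tw) //=.
  by rewrite -{1}bm beta_desc_le.
by have := par_not_desc AT Tw; rewrite -um wu.
Qed.

(** All vertices descend from the root, whereas a leaf has only itself as a descendant. *)
Lemma largest_leaf_par : m \in A -> 1 < #|A| -> exists v q, T m = Some (v, q).
Proof.
have [AT bT bm] := largest_leafP _ _ _ lT => mA.
rewrite (cardsD1 m) mA ltnS => /card_gt0P[w]; rewrite !inE => /andP[wm wA].
case Tm: (T m) => [[v q]|]; first by exists v, q.
have [r [rA Tr rw]] := root_exists AT; have := Tr m mA; rewrite Tm eqxx => /esym/eqP mr.
by have := desc_leaf largest_leaf_leaf (etrans (congr1 (desc T ^~ w) mr) (rw w wA));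
  move/eqP; rewrite (negbTE wm).
Qed.

(** A child [w] of [v] has [beta T w = m], so [w] lies on the path from [m] up to the root. Unless
    [w] is [m], it lies above its own parent [v]. *)
Lemma only_child v q w i :
  T m = Some (v, q) -> beta T v = m -> T w = Some (v, i) -> w = m.
Proof.
have [AT bT bm] := largest_leafP _ _ _ lT => Tm bv Tw.
have vw : desc T v w by rewrite (desc_some _ Tw) desc_refl orbT.
have [u wu bu] := beta_desc T w.
have um : u = m.
  apply: val_inj; rewrite /= -bu; apply/eqP; rewrite eqn_leq bT ?(vertex_in AT Tw) //=.
  by rewrite -bv beta_desc_le.
move: wu; rewrite um (desc_some _ Tm) => /orP[/eqP->//|wv].
by have := par_not_desc AT Tw; rewrite wv.
Qed.

End Facts.
End LargestLeaf.

(** * Weight sums *)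

Section Weights.
Variables (n : nat) (K : comNzRingType) (x y t : K).
Implicit Types (T : ptree n) (u v w m q i : 'I_n) (A B : {set 'I_n}).
Local Open Scope ring_scope.

(** Ordinal 0 is the label 1. The edge to an elder child is proper by definition, so it carries no
    [y]. *)
Definition vertex_weight T w : K :=
  if T w is Some (p, _)
  then if elder T w then t
       else (if val p == 0%N then x else 1) * (if (p < beta T w)%N then 1 else y)
  else 1.

Definition tree_weight T : K := \prod_w vertex_weight T w.

(** The weight of a leaf [m] that is a younger child of [v]. *)
Definition attach_weight v m : K :=
  (if val v == 0%N then x else 1) * (if (v < m)%N then 1 else y).

Definition below_sum A k : K := \sum_(T | below A k T) tree_weight T.

Definition largest_leaf_sum A m : K := \sum_(T | largest_leaf A m T) tree_weight T.

Lemma below_sum0 A : A != set0 -> below_sum A 0 = 0.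
Proof.
case/set0Pn => w wA; apply: big_pred0 => T.
by apply/negP=> /belowP[_ /(_ w wA)].
Qed.

(** If some [beta] equals [m], then [m] is a descendant of that vertex, which forces
    [beta T m = m]. *)
Lemma below_sumS A m : m \in A ->
  below_sum A m.+1 = below_sum A m + largest_leaf_sum A m.
Proof.
move=> mA; rewrite /below_sum (bigID (fun T => beta T m == m)) addrC /=.
congr (_ + _); apply: eq_bigl => T.
apply/andP/belowP => [[/belowP[AT bT] bm]|[AT bT]]; split=> //; last 2 first.
- by apply/belowP; split=> // w /bT/ltnW.
- by rewrite neq_ltn bT.
move=> w wA; rewrite ltn_neqAle -ltnS bT // andbT; apply: contraNneq bm => bw.
have [u wu bu] := beta_desc T w; rewrite bw in bu.
by rewrite eqn_leq -ltnS bT //= -{1}bw; apply: beta_desc_le; rewrite (val_inj bu).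
Qed.

Lemma below_sum_skip A k : (forall w, w \in A -> val w != k) ->
  below_sum A k.+1 = below_sum A k.
Proof.
move=> kA; apply: eq_bigl => T; apply/belowP/belowP => -[AT bT]; split=> // w wA.
  rewrite ltn_neqAle -ltnS bT // andbT; have [u wu ->] := beta_desc T w.
  exact: kA (desc_in AT wA wu).
exact/ltnW/bT.
Qed.

Lemma tree_weight_add A T m v q :
    m \in A -> plane_tree_on (A :\ m) T -> v \in A :\ m -> (q <= deg T v)%N ->
    (forall w, w \in A :\ m -> beta T w < m)%N ->
  tree_weight (add_leaf T m v q) =
  tree_weight T * (if (q < deg T v)%N then t else attach_weight v m).
Proof.
move=> mA BT vB q_le bT; rewrite /tree_weight (bigD1 m) //= [in RHS](bigD1 m) //=.
rewrite [vertex_weight T m]/vertex_weight (removed_none BT) mul1r mulrC; congr (_ * _).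
  apply: eq_bigr => w wm; rewrite /vertex_weight.
  have := add_leaf_neq T v q wm; case Tw: (T w) => [[p i]|] ->//.
  have wB := vertex_in BT Tw.
  by rewrite (add_leaf_elder mA BT vB q_le bT wB) (add_leaf_beta q BT vB bT wB).
rewrite /vertex_weight add_leaf_m (add_leaf_elder_m mA BT vB q_le bT).
by case: ifP => // _; rewrite (add_leaf_beta_m q BT vB).
Qed.

(** Deleting [m] is a bijection onto triples of a tree [T], a vertex [v] and a position
    [q <= deg T v]. *)
Lemma largest_leaf_sum_outer A m : m \in A ->
  \sum_(T | largest_leaf A m T && (beta T (parent T m) < m)%N) tree_weight T =
  below_sum (A :\ m) m *
  (\sum_(v in A :\ m) attach_weight v m + (#|A :\ m|.-1)%:R * t).
Proof.
move=> mA.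
pose ins (z : ptree n * ('I_n * 'I_n)) := add_leaf z.1 m z.2.1 z.2.2.
(* The default [(m, m)] is never met: a root [m] is its own [parent], and its [beta] is [m], not
   less. *)
pose rmv T := let c := if T m is Some c then c else (m, m) in
  (del_leaf T m c.1 c.2, c).
rewrite (reindex_onto ins rmv) /=; last first.
  move=> T /andP[lT bp]; rewrite /ins /rmv.
  case Tm: (T m) bp => [[v q]|]; last first.
    by rewrite /parent Tm; have [_ _ ->] := largest_leafP _ _ _ lT; rewrite ltnn.
  have [AT _ _] := largest_leafP _ _ _ lT => _ /=.
  exact: (add_del_leaf AT Tm).
rewrite (eq_bigl (fun z : ptree n * ('I_n * 'I_n) => below (A :\ m) m z.1 &&
                     ((z.2.1 \in A :\ m) && (z.2.2 <= deg z.1 z.2.1)%N))); last first.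
  move=> [T [v q]]; rewrite /ins /rmv /= add_leaf_m /=.
  apply/andP/andP => [[/andP[lT bp] /eqP[dT]]|[/belowP[BT bT] /andP[vB q_le]]].
    have Tm := add_leaf_m T m v q; have [AT bT _] := largest_leafP _ _ _ lT.
    have lf := largest_leaf_leaf lT.
    rewrite (parent_some Tm) in bp.
    rewrite -dT; split; last by rewrite (del_leaf_par AT lf Tm) (del_leaf_pos AT Tm).
    apply/belowP; split; first exact: del_leaf_plane.
    by move=> w wB; apply: (del_leaf_beta (A := A)).
  have AT := add_leaf_plane mA BT vB q_le.
  rewrite (del_add_leaf v q BT) ?eqxx; split=> //; apply/andP; split.
    apply/largest_leafP; split=> //; last exact: (add_leaf_beta_m q BT vB).
    move=> w wA; have [->|wm] := eqVneq w m; first by rewrite (add_leaf_beta_m q BT vB).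
    have wB : w \in A :\ m by rewrite !inE wm.
    by rewrite (add_leaf_beta q BT vB bT wB) ltnW // bT.
  by rewrite (parent_some (add_leaf_m T m v q)) (add_leaf_beta q BT vB bT vB) bT.
rewrite -(pair_big_dep (fun T => below (A :\ m) m T)
  (fun T (z : 'I_n * 'I_n) => (z.1 \in A :\ m) && (z.2 <= deg T z.1)%N)
  (fun T z => tree_weight (ins (T, z)))) /=.
rewrite /below_sum big_distrl /=; apply: eq_bigr => T /belowP[BT bT].
(* Writing [#|A :\ m|.-1] as the sum of the degrees lets both sides be compared vertex by vertex. *)
rewrite -(sum_deg BT) natr_sum big_distrl /= -big_split /=.
rewrite -(pair_big_dep (fun v => v \in A :\ m)
  (fun v (q : 'I_n) => (q <= deg T v)%N) (fun v q => tree_weight (ins (T, (v, q))))) /=.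
rewrite big_distrr /=; apply: eq_bigr => v vB.
have deg_n : (deg T v < n)%N.
  apply: leq_trans (deg_lt BT vB) _.
  by rewrite -[X in (_ <= X)%N]card_ord max_card.
(* Position [deg T v] is the rightmost one, where [m] is younger; each of the [deg T v] others makes
   it elder. *)
rewrite (bigD1 (Ordinal deg_n)) //= /ins /= (tree_weight_add mA) //= ltnn mulrDr.
congr (_ + _).
rewrite (eq_bigl (fun q : 'I_n => (q < deg T v)%N)); last first.
  by move=> q; rewrite -val_eqE /= andbC ltn_neqAle.
rewrite (eq_bigr (fun=> tree_weight T * t)); last first.
  by move=> q q_lt; rewrite (tree_weight_add mA) ?q_lt // ltnW.
rewrite sumr_const -mulrnAr -[in LHS]mulr_natl; congr (_ * (_%:R * _)).
by rewrite -sum1_card -(big_ord_widen n (fun=> 1%N) (ltnW deg_n)) sum1_card card_ord.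
Qed.

(** The factor [y] is the weight of [m]: a younger child on an improper edge, below a vertex [v > m]
    that cannot be ordinal 0. The other weights are transposed. *)
Lemma tree_weight_exchange (A : {set 'I_n}) T T0 m v :
    m \in A -> v \in A -> (m < v)%N ->
    (forall w, w != m -> T w = T0 (tperm m v w)) ->
    (forall w p i, T0 w = Some (p, i) -> p != m /\ p != v) ->
    T m = Some (v, ord_zero m) -> T0 v = None ->
  tree_weight T = y * tree_weight T0.
Proof.
move=> mA vA lt_mv ex T0p Tm T0v; rewrite /tree_weight (bigD1 m) //=; congr (_ * _).
  rewrite /vertex_weight Tm (negbTE (exch_elder_m ex T0p Tm)).
  rewrite (exch_beta_m lt_mv ex T0p Tm) ltnNge (ltnW lt_mv) /=.
  by rewrite -[_ == _]negbK -lt0n (leq_ltn_trans _ lt_mv) //= mul1r.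
rewrite [RHS](bigD1 v) //= [vertex_weight T0 v]/vertex_weight T0v mul1r.
rewrite [RHS](reindex_inj (@perm_inj _ (tperm m v))) /=.
apply: eq_big => [w|w wm].
  by rewrite -{2}(tpermL m v) (inj_eq perm_inj).
rewrite /vertex_weight -ex //; case: (T w) => [[p i]|//].
by rewrite (exch_elder lt_mv ex T0p Tm T0v) // (exch_beta lt_mv ex T0p Tm T0v).
Qed.

(** Here the parent [v] has [beta T v = m], so [m] is its only child and [v > m]; contraction is
    then a bijection for each [v]. *)
Lemma largest_leaf_sum_inner A m : m \in A -> (1 < #|A|)%N ->
  \sum_(T | largest_leaf A m T && ~~ (beta T (parent T m) < m)%N) tree_weight T =
  y * \sum_(v in A | (m < v)%N) largest_leaf_sum (A :\ v) m.
Proof.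
move=> mA A_gt1.
pose ins (z : 'I_n * ptree n) := expand_leaf z.2 m z.1.
pose rmv T := (parent T m, contract_leaf T m (parent T m)).
have fwd T : largest_leaf A m T && ~~ (beta T (parent T m) < m)%N ->
    [/\ parent T m \in A, (m < parent T m)%N, ins (rmv T) = T &
      largest_leaf (A :\ parent T m) m (rmv T).2].
  case/andP=> lT; rewrite -leqNgt => bp; have [AT bT bm] := largest_leafP _ _ _ lT.
  have [v [q Tm]] := largest_leaf_par lT mA A_gt1; have lf := largest_leaf_leaf lT.
  rewrite /ins /rmv (parent_some Tm) /= in bp *.
  have vA := par_in AT Tm; have {}bp : beta T v = m :> nat.
    by apply/eqP; rewrite eqn_leq bT.
  have lt_mv : (m < v)%N.
    rewrite ltn_neqAle -{2}bp beta_le ?desc_refl // andbT.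
    by have := par_neq AT Tm; rewrite -val_eqE.
  have deg1 : deg T v = 1%N.
    rewrite /deg -(cards1 m); apply: eq_card => w; rewrite !inE /isChild.
    apply/prelP/eqP => [[i /(only_child lT Tm bp)//]|->]; by exists q.
  have q0 : q = ord_zero m.
    by apply: val_inj; have := pos_lt_deg AT Tm; rewrite deg1 /=; case: (val q).
  rewrite {}q0 in Tm; set T0 := contract_leaf T m v.
  have ex w : w != m -> T w = T0 (tperm m v w).
    move=> wm; rewrite ffunE tpermK ifF //; apply/negbTE.
    by apply: contraNneq wm => /(canRL (tpermK m v)) ->; rewrite tpermR.
  have T0p w p i : T0 w = Some (p, i) -> p != m /\ p != v.
    rewrite ffunE; case: eqVneq => // wv Tw; split.
      by apply: contraTneq (lf (tperm m v w)) => pm; rewrite (prel_some _ Tw) pm eqxx.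
    apply: contraNneq wv => pv; move: Tw; rewrite pv => /(only_child lT Tm bp).
    by move/(canRL (tpermK m v)) ->; rewrite tpermL.
  have T0v : T0 v = None by rewrite ffunE eqxx.
  split=> //.
    by apply/ffunP=> w; rewrite ffunE; case: eqVneq => [->//|wm]; rewrite -ex.
  apply/largest_leafP; split.
  - by rewrite (exch_plane lt_mv ex T0p Tm T0v mA vA).
  - move=> w; rewrite !inE => /andP[wv wA].
    have wm : tperm m v w != m by exact: tperm_neq_m.
    rewrite -[w](tpermK m v) -(exch_beta lt_mv ex T0p Tm T0v) // bT //.
    by rewrite (tperm_in mA vA).
  - by have := exch_beta lt_mv ex T0p Tm T0v (neq_vm lt_mv); rewrite tpermR bp.
rewrite (reindex_onto ins rmv) /=; last by move=> T /fwd[].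
rewrite big_distrr /= (eq_bigr (fun v =>
  \sum_(T | largest_leaf (A :\ v) m T) y * tree_weight T)); last first.
  by move=> v _; rewrite /largest_leaf_sum big_distrr.
rewrite pair_big_dep /=.
have bwd v T0 : v \in A -> (m < v)%N -> largest_leaf (A :\ v) m T0 ->
  let T := ins (v, T0) in
  [/\ largest_leaf A m T, ~~ (beta T (parent T m) < m)%N, rmv T = (v, T0)
    & tree_weight T = y * tree_weight T0].
  move=> vA lt_mv lT T; have [BT bT bm] := largest_leafP _ _ _ lT.
  have Tm : T m = Some (v, ord_zero m) by rewrite ffunE eqxx.
  have ex w : w != m -> T w = T0 (tperm m v w) by move=> /negbTE wm; rewrite ffunE wm.
  have T0v : T0 v = None by rewrite (vertex_out BT) // !inE eqxx.
  have T0p w p i : T0 w = Some (p, i) -> p != m /\ p != v.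
    move=> Tw; split; last by have := par_in BT Tw; rewrite !inE => /andP[].
    apply: contraTneq (largest_leaf_leaf lT w) => pm.
    by rewrite (prel_some _ Tw) pm eqxx.
  have bvm : beta T v = m.
    by rewrite (exch_beta lt_mv ex T0p Tm T0v) ?tpermR ?bm // (neq_vm lt_mv).
  split; last exact: (tree_weight_exchange mA vA lt_mv ex T0p Tm T0v).
  - apply/largest_leafP; split; first by rewrite -(exch_plane lt_mv ex T0p Tm T0v mA vA).
      move=> w wA; have [->|wm] := eqVneq w m.
        by rewrite (exch_beta_m lt_mv ex T0p Tm).
      rewrite (exch_beta lt_mv ex T0p Tm T0v) // bT // !inE tperm_neq //.
      by rewrite (tperm_in mA vA).
    exact: (exch_beta_m lt_mv ex T0p Tm).
  - by rewrite (parent_some Tm) bvm ltnn.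
  rewrite /rmv (parent_some Tm); congr (_, _); apply/ffunP=> w; rewrite ffunE.
  case: eqVneq => [->//|wv]; rewrite ex ?tpermK //; exact: tperm_neq_m.
apply: eq_big => [[v T0]|[v T0]] /=.
  apply/andP/andP => [[/fwd[] + + _ + /eqP e]|[/andP[vA lt_mv] lT]].
    (* By [e], [rmv] undoes [ins] on this pair, so the [parent] of [m] is the first component
       [v]. *)
    by rewrite e /= -[parent _ _]/((rmv (ins (v, T0))).1) e /= => -> ->.
  by have [-> -> -> _] := bwd v T0 vA lt_mv lT; rewrite eqxx.
case/andP=> /fwd[] + + _ + /eqP e.
rewrite e /= -[parent _ _]/((rmv (ins (v, T0))).1) e /= => vA lt_mv lT.
by have [_ _ _ ->] := bwd v T0 vA lt_mv lT.
Qed.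

Lemma largest_leaf_sum_rec A m : m \in A -> (1 < #|A|)%N ->
  largest_leaf_sum A m =
  below_sum (A :\ m) m *
    (\sum_(v in A :\ m) attach_weight v m + (#|A :\ m|.-1)%:R * t) +
  y * \sum_(v in A | (m < v)%N) largest_leaf_sum (A :\ v) m.
Proof.
move=> mA A_gt1; rewrite -largest_leaf_sum_outer // -largest_leaf_sum_inner //.
exact: bigID.
Qed.

Lemma largest_leaf_sum1 m : largest_leaf_sum [set m] m = 1.
Proof.
pose T0 : ptree n := [ffun=> None].
have T0E w : T0 w = None by rewrite ffunE.
rewrite /largest_leaf_sum (big_pred1 T0) => [|T].
  by rewrite /tree_weight big1 // => w _; rewrite /vertex_weight T0E.
apply/idP/eqP => [/largest_leafP[AT _ _]|->].
  apply/ffunP=> w; rewrite T0E; case Tw: (T w) => [[p i]|//].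
  have /set1P wm := vertex_in AT Tw; have /set1P pm := par_in AT Tw.
  by have := par_neq AT Tw; rewrite wm pm eqxx.
have b w : beta T0 w = w.
  by apply: leaf_beta => u; rewrite prel_none.
apply/largest_leafP; split; rewrite ?b //.
  apply/plane_tree_onP; split=> [w _|w p i|w1 w2 c|]; rewrite ?T0E //.
  exists m; rewrite inE eqxx T0E; split=> // w /set1P->; exact: desc_refl.
by move=> w /set1P->; rewrite b.
Qed.

End Weights.

(** * Solving the recursion *)

Section CountingPolynomials.
Variables (K : comNzRingType) (x y t : K).
Implicit Types (P : {poly K}) (c : K).
Local Open Scope ring_scope.

(* In terms of [s] with ['X = 1 / (1 - y s)], [y_deriv] is [d / ds], and
   [taylor i P] is the [i]-th derivative at [s = 0], i.e. at ['X = 1]. *)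
Definition y_deriv P : {poly K} := y *: ('X ^+ 2 * P^`()).

Definition taylor i P : K := (iter i y_deriv P).[1].

Lemma taylorS i P : taylor i.+1 P = taylor i (y_deriv P).
Proof. by rewrite /taylor iterSr. Qed.

Lemma taylorD i P1 P2 : taylor i (P1 + P2) = taylor i P1 + taylor i P2.
Proof.
elim: i P1 P2 => [|i IHi] P1 P2; first by rewrite /taylor hornerD.
by rewrite !taylorS -IHi /y_deriv derivD mulrDr scalerDr.
Qed.

Lemma taylorZ i c P : taylor i (c *: P) = c * taylor i P.
Proof.
elim: i P => [|i IHi] P; first by rewrite /taylor hornerZ.
by rewrite !taylorS -IHi /y_deriv derivZ -scalerAr !scalerA mulrC.
Qed.

Lemma taylor0 i : taylor i 0 = 0.
Proof. by rewrite -(scale0r (0 : {poly K})) taylorZ mul0r. Qed.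

(** With ['X = 1 / (1 - y s)] one has ['X - 1 = y s 'X], and multiplying an exponential series by
    [s] turns its coefficients [a_i] into [i a_(i-1)]. *)
Lemma taylor_mulX1 i P :
  taylor i (('X - 1) * P) = i%:R * (y * taylor i.-1 ('X * P)).
Proof.
elim: i P => [|i IHi] P; first by rewrite /taylor !hornerE subrr !mul0r.
rewrite taylorS.
have -> : y_deriv (('X - 1) * P) = y *: (('X - 1) * ('X * P)) + y *: ('X * P)
                                   + ('X - 1) * y_deriv P.
  rewrite /y_deriv derivM derivB derivX derivC -!mul_polyC; ring.
rewrite !taylorD !taylorZ !IHi /=; case: i {IHi} => [|i] /=; first by ring.
have -> : taylor i.+1 ('X * P) = y * taylor i ('X * ('X * P)) + taylor i ('X * y_deriv P).
  rewrite taylorS -taylorZ -taylorD; congr taylor.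
  by rewrite /y_deriv derivM derivX -!mul_polyC; ring.
by rewrite -[i.+2]addn1 natrD; ring.
Qed.

(** This has the shape of the contraction term: [i] choices of a large label, a factor [y], and one
    large label fewer. *)
Lemma taylor_mulX i P :
  taylor i ('X * P) = taylor i P + i%:R * (y * taylor i.-1 ('X * P)).
Proof. by rewrite -taylor_mulX1 -taylorD; congr taylor; ring. Qed.

(** The operator on the left is [s d/ds]. *)
Lemma taylor_euler i P : taylor i ('X * ('X - 1) * P^`()) = i%:R * taylor i P.
Proof.
have -> : 'X * ('X - 1) * P^`() = ('X - 1) * ('X * P^`()) by ring.
rewrite taylor_mulX1; case: i => [|i]; first by rewrite !mul0r.
rewrite taylorS /= -taylorZ /y_deriv; congr (_ * taylor i _).
by rewrite mulrA expr2.
Qed.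

(** The factor for attaching the leaf is [leaf_factor j + i (y + t)], with [i] larger and [j]
    smaller labels. *)
Definition leaf_factor j : K := x + j.-1%:R * (1 + t).

(** The series for the trees whose leaf can be deleted, the factor [i] becoming [s d/ds]. For
    [j = 0] only the one-vertex tree remains, hence the constant 1. *)
Definition top_poly j P : {poly K} :=
  if j is 0 then 1 else leaf_factor j *: P + (y + t) *: ('X * ('X - 1) * P^`()).

(* Exponential generating function, in the number of labels above the threshold,
   of the weight sums with [j] labels below it. *)
Fixpoint tree_poly j : {poly K} :=
  if j is j'.+1
  then y_deriv (tree_poly j') + 'X * top_poly j' (tree_poly j') else 0.

Section Counts.
Variable n : nat.
Implicit Types (A : {set 'I_n.+1}) (m v : 'I_n.+1).

Definition bigs A (k : nat) := [set v in A | (k <= v)%N].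
Definition smalls A (k : nat) := [set v in A | (v < k)%N].

Lemma card_bigs_smalls A k : #|A| = (#|bigs A k| + #|smalls A k|)%N.
Proof.
rewrite -(cardsID [set v : 'I_n.+1 | (k <= v)%N] A); congr (_ + _)%N; apply: eq_card => v.
  by rewrite !inE.
by rewrite !inE -ltnNge andbC.
Qed.

Lemma bigs_in A m : m \in A -> #|bigs A m| = #|bigs A m.+1|.+1.
Proof.
move=> mA; rewrite (cardsD1 m) !inE mA leqnn /=; congr _.+1; apply: eq_card => v.
by rewrite !inE ltn_neqAle -val_eqE eq_sym andbCA.
Qed.

Lemma smalls_in A m : m \in A -> #|smalls A m.+1| = #|smalls A m|.+1.
Proof.
move=> mA; rewrite (cardsD1 m) !inE mA leqnn /=; congr _.+1; apply: eq_card => v.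
by rewrite !inE ltnS [in RHS]ltn_neqAle -val_eqE andbCA.
Qed.

(** Ordinal 0 contributes [x], every other smaller label 1 and every larger label [y]. *)
Lemma sum_attach_weight A m : ord0 \in A -> m \in A -> (0 < m)%N ->
  \sum_(v in A :\ m) attach_weight x y v m =
  x + #|smalls A m|.-1%:R + #|bigs A m.+1|%:R * y.
Proof.
move=> A0 mA m_gt0.
rewrite (bigID (fun v : 'I_n.+1 => (v < m)%N)) /=; congr (_ + _).
  rewrite (bigD1 ord0) /=; last by rewrite !inE A0 m_gt0 !andbT -val_eqE /= ltn_eqF.
  rewrite /attach_weight /= m_gt0 mulr1; congr (_ + _).
  rewrite (eq_bigr (fun=> 1)) => [|v /andP[/andP[_ ->]]]; last first.
    by rewrite -val_eqE /= => /negbTE->; rewrite mulr1.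
  rewrite sumr_const; congr (_%:R); rewrite (cardsD1 ord0) !inE A0 m_gt0 /= add0n.
  apply: eq_card => v; rewrite [LHS]unfold_in !inE; have [->|vm] := eqVneq v m.
    by rewrite ltnn !andbF.
  by rewrite andbC.
rewrite (eq_bigr (fun=> y)) => [|v /andP[_ vm]]; last first.
  rewrite /attach_weight (negbTE vm); case: eqP => [v0|]; last by rewrite mul1r.
  by rewrite v0 m_gt0 in vm.
rewrite sumr_const mulr_natl; congr (_ *+ _); apply: eq_card => v.
rewrite [LHS]unfold_in !inE -leqNgt ltn_neqAle -val_eqE eq_sym.
by case: (v \in A); rewrite ?andbF ?andbT.
Qed.

(** Induction on [#|A|]: a contraction removes a larger label and keeps the smaller ones, so the
    recursion becomes [taylor_mulX]. *)
Lemma largest_leaf_sumE m :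
    (forall A, ord0 \in A ->
       below_sum x y t A m = taylor #|bigs A m| (tree_poly #|smalls A m|)) ->
  forall A, ord0 \in A -> m \in A ->
  largest_leaf_sum x y t A m =
  taylor #|bigs A m.+1| ('X * top_poly #|smalls A m| (tree_poly #|smalls A m|)).
Proof.
move=> IHm A; have [k] := ubnP #|A|; elim: k A => // k IHk A; rewrite ltnS => Ak A0 mA.
have cA := card_bigs_smalls A m; rewrite bigs_in // in cA.
have [A1|A1] := leqP #|A| 1.
  have Am : A = [set m].
    by apply/eqP; rewrite eq_sym eqEcard sub1set mA cards1.
  have m0 : ord0 = m :> 'I_n.+1 by apply/set1P; rewrite -Am.
  have [-> ->] : #|bigs A m.+1| = 0%N /\ #|smalls A m| = 0%N by lia.
  by rewrite Am largest_leaf_sum1 /taylor /= mulr1 hornerX.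
rewrite largest_leaf_sum_rec // taylor_mulX.
have -> : \sum_(v in A | (m < v)%N) largest_leaf_sum x y t (A :\ v) m =
    #|bigs A m.+1|%:R *
    taylor #|bigs A m.+1|.-1 ('X * top_poly #|smalls A m| (tree_poly #|smalls A m|)).
  rewrite mulr_natl -sumr_const; apply: eq_big => [v|v /andP[vA lt_mv]].
    by rewrite inE.
  have vm : v != m by rewrite -val_eqE gtn_eqF.
  have -> : #|bigs A m.+1|.-1 = #|bigs (A :\ v) m.+1|.
    rewrite (cardsD1 v) !inE vA lt_mv; apply: eq_card => w.
    by rewrite !inE andbA.
  have -> : #|smalls A m| = #|smalls (A :\ v) m|.
    apply: eq_card => w; rewrite !inE; have [->|//] := eqVneq w v.
    by rewrite ltnNge (ltnW lt_mv) andbF.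
  apply: IHk.
  - by rewrite (cardsD1 v) vA in Ak.
  - by rewrite !inE A0 andbT -val_eqE /= ltn_eqF // (leq_ltn_trans _ lt_mv).
  - by rewrite !inE mA andbT eq_sym.
rewrite mulrCA; congr (_ + _).
have cB : #|A :\ m| = (#|A|).-1 by rewrite [in RHS](cardsD1 m) mA.
have bB : #|bigs (A :\ m) m| = #|bigs A m.+1|.
  apply: eq_card => w; rewrite !inE ltn_neqAle -val_eqE eq_sym.
  by case: (w \in A); rewrite ?andbF ?andbT.
have sB : #|smalls (A :\ m) m| = #|smalls A m|.
  apply: eq_card => w; rewrite !inE; have [->|//] := eqVneq w m.
  by rewrite ltnn !andbF.
(* For [m = 0] no tree has its [beta] below [m]; on the other side the constant 1 has no Taylor
   coefficient of positive order. *)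
have [m0|m_gt0] := posnP m.
  rewrite [in LHS]m0 below_sum0 ?mul0r; last first.
    by rewrite -card_gt0 cB; lia.
  have s0 : #|smalls A m| = 0%N.
    by apply/eqP; rewrite cards_eq0; apply/eqP/setP=> w; rewrite !inE m0 andbF.
  rewrite s0 /=; have: (0 < #|bigs A m.+1|)%N by lia.
  case: #|bigs A m.+1| => // i _; rewrite taylorS /y_deriv derivC mulr0 scaler0.
  by rewrite taylor0.
have Bm0 : ord0 \in A :\ m by rewrite !inE A0 andbT -val_eqE /= ltn_eqF.
rewrite IHm // sum_attach_weight // bB sB cB cA; move: (tree_poly _) => P.
have : (0 < #|smalls A m|)%N by apply/card_gt0P; exists ord0; rewrite inE A0.
case: #|smalls A m| => // j _; rewrite addSn addnS /=.
by rewrite taylorD !taylorZ taylor_euler /leaf_factor /= natrD; ring.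
Qed.

(** When the threshold passes a label of [A], that label turns from large to small: [i] drops by
    one, which is [y_deriv], and the largest-leaf term is added, as in [tree_poly]. *)
Lemma below_sumE k A : ord0 \in A ->
  below_sum x y t A k = taylor #|bigs A k| (tree_poly #|smalls A k|).
Proof.
elim: k A => [|k IHk] A A0.
  rewrite below_sum0; last by apply/set0Pn; exists ord0.
  have -> : smalls A 0 = set0 by apply/setP=> v; rewrite !inE andbF.
  by rewrite cards0 taylor0.
have [/existsP[m /andP[mA /eqP mk]]|no_k] :=
  boolP [exists m : 'I_n.+1, (m \in A) && (val m == k)].
  rewrite -{}mk in IHk *.
  rewrite below_sumS // IHk // largest_leaf_sumE // bigs_in // smalls_in //.
  by rewrite /= taylorS -taylorD.
have kA v : v \in A -> val v != k.
  by move=> vA; apply: contra no_k => vk; apply/existsP; exists v; rewrite vA.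
rewrite below_sum_skip // IHk //; congr (taylor _ (tree_poly _)); apply: eq_card => v.
  by rewrite !inE ltn_neqAle eq_sym; case vA: (v \in A); rewrite //= kA.
by rewrite !inE ltnS (leq_eqVlt v); case vA: (v \in A); rewrite //= (negbTE (kA v vA)).
Qed.

Lemma below_sumT : below_sum x y t [set: 'I_n.+1] n.+1 = (tree_poly n.+1).[1].
Proof.
rewrite below_sumE ?inE //.
have -> : bigs setT n.+1 = set0 by apply/setP=> v; rewrite !inE leqNgt ltn_ord.
have -> : smalls setT n.+1 = setT by apply/setP=> v; rewrite !inE ltn_ord.
by rewrite cards0 cardsT card_ord.
Qed.

End Counts.
End CountingPolynomials.

(** * The tree polynomials in terms of the recurrence for [Q_n] *)

Section Substitution.
Variables (K : comNzRingType) (x t : K).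
Implicit Types (q : {poly K}).
Local Open Scope ring_scope.

(** The recurrence after the substitution, with [x - t - 1 + m + m t] collected as
    [x + (m - 1)(1 + t)]. *)
Definition Q_step m q : {poly K} :=
  (x + (m.-1)%:R * (1 + t))%:P * q + m%:R * ('X * q) + 'X * ('X + t%:P) * q^`().

(* [Q_poly m] is [Q_(m+1)] with [z = 1] and [x] replaced by [x - t - 1]. *)
Fixpoint Q_poly m : {poly K} := if m is m'.+1 then Q_step m (Q_poly m') else 1.

(** The inner variable is [y] and the outer one [w]; this is [(y + t) w - t], which equals [y] at
    [w = 1]. *)
Let c : {poly {poly K}} := ('X + t%:P)%:P * 'X - t%:P%:P.

(** For [u = tree_poly m.+1], the two terms with [u'] add up to [w^2 c u'], because
    [y + (y + t)(w - 1) = c]. The chain rule brings in [(y + t) w = c + t], which gives [Q_step] at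
    [c]. *)
Lemma tree_polyE m :
  tree_poly x%:P 'X t%:P m.+1 = 'X ^+ m.+1 * (map_poly polyC (Q_poly m) \Po c).
Proof.
elim: m => [|m IHm].
  by rewrite /= /y_deriv deriv0 mulr0 scaler0 add0r mulr1 rmorph1 comp_polyC mulr1.
set u := tree_poly _ _ _ _ in IHm.
rewrite -[LHS]/(y_deriv 'X u + 'X * top_poly x%:P 'X t%:P m.+1 u) {u}IHm.
rewrite -[Q_poly m.+1]/(Q_step m.+1 (Q_poly m)) /top_poly /y_deriv /leaf_factor /Q_step.
have dc : c^`() = ('X + t%:P)%:P.
  by rewrite /c derivB derivM !derivC derivX mul0r add0r mulr1 subr0.
rewrite derivM derivXn deriv_comp dc deriv_map.
have phiC a : map_poly polyC a%:P \Po c = a%:P%:P by rewrite map_polyC comp_polyC.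
have phiX : map_poly polyC 'X \Po c = c by rewrite map_polyX comp_polyX.
rewrite !(rmorphD, rmorphM, rmorph1, rmorph_nat) /= phiX !phiC.
move: (_ \Po c) (_ \Po c) => p q.
rewrite -!mul_polyC /c !(rmorphD, rmorphM, rmorph1, rmorph_nat) /=.
rewrite -mulr_natl -!natr1 !exprS; move: ('X ^+ m) => w.
ring.
Qed.

Lemma tree_poly1 m : (tree_poly x%:P 'X t%:P m.+1).[1] = Q_poly m.
Proof.
rewrite tree_polyE hornerM hornerXn expr1n mul1r horner_comp /c.
rewrite hornerD hornerN hornerM !hornerC hornerX mulr1 addrK.
exact: comp_polyXr.
Qed.

End Substitution.

(** * The polynomials [Q_n] *)

Section Statistics.
Variable n : nat.
Implicit Types (T : ptree n).
Local Open Scope ring_scope.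

Lemma plane_tree_onT T : is_plane_tree T = plane_tree_on setT T.
Proof.
apply/and4P/plane_tree_onP => [[/cards1P[r rP] /forallP dP /forallP iP /forallP cP]|].
  have Tr w : (T w == None) = (w == r).
    by have := in_set1 w r; rewrite -rP inE.
  split=> [w|w p i Tw|w1 w2 [p i] T1 T2|]; first by rewrite inE.
  - split; first by rewrite inE.
    move/forallP/(_ w)/implyP: (dP p); rewrite /isChild (prel_some _ Tw) eqxx /pos Tw.
    exact.
  - apply/eqP; move/forallP/(_ w1)/forallP/(_ w2)/implyP: (iP p); apply.
    by rewrite /isChild (prel_some _ T1) (prel_some _ T2) /pos T1 T2 !eqxx.
  exists r; rewrite inE; split=> [//||w _]; first by apply/eqP; rewrite Tr.
  by have /existsP[r' /andP[]] := cP w; rewrite Tr => /eqP->.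
move=> PT; have {PT} : plane_tree_on setT T by apply/plane_tree_onP.
move=> PT; have [r [_ Tr rw]] := root_exists PT; split.
- apply/cards1P; exists r; apply/setP=> w; by rewrite !inE Tr ?inE.
- apply/forallP=> p; apply/forallP=> w; apply/implyP=> /prelP[i Tw].
  by rewrite /pos Tw (pos_lt_deg PT Tw).
- apply/forallP=> p; apply/forallP=> w1; apply/forallP=> w2.
  apply/implyP=> /and3P[/prelP[i1 T1] /prelP[i2 T2]]; rewrite /pos T1 T2.
  by move=> /eqP/val_inj ii; apply/eqP; apply: (pos_inj PT T1); rewrite T2 ii.
apply/forallP=> w; apply/existsP; exists r.
by rewrite Tr ?inE // eqxx; apply: rw; rewrite inE.
Qed.

(** An edge is determined by its child. *)
Lemma nimproperE T :
  nimproper T = #|[set w | if T w is Some (p, _) then ~~ Defs.proper T p w else false]|.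
Proof.
rewrite /nimproper -(card_in_imset (f := snd)); last first.
  move=> [p1 w1] [p2 w2]; rewrite !inE /isChild /=.
  move=> /andP[/prelP[i T1] _] /andP[/prelP[j T2] _] ww.
  by move: T2; rewrite -ww T1 => -[-> _].
apply: eq_card => w; rewrite [RHS]inE; apply/imsetP/idP => [[[p w'] + ->]|].
  by rewrite inE /= /isChild => /andP[/prelP[i ->]].
case Tw: (T w) => [[p i]|//] impr; exists (p, w) => //.
by rewrite inE /isChild (prel_some _ Tw) eqxx.
Qed.

Lemma tree_weightE (K : comNzRingType) (x y t : K) T :
  tree_weight x y t T = x ^+ youngAt T 0 * t ^+ eld T * y ^+ nimproper T.
Proof.
have expE (z : K) (S : {set 'I_n}) : z ^+ #|S| = \prod_w (if w \in S then z else 1).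
  by rewrite -big_mkcond /= prodr_const.
rewrite nimproperE /youngAt /eld !expE -!big_split /=; apply: eq_bigr => w _.
rewrite /vertex_weight !inE; case Tw: (T w) => [[p i]|].
  rewrite /Defs.proper; case: (elder T w) => /=; first by rewrite andbF mul1r mulr1.
  by rewrite andbT mulr1; case: (p < beta T w)%N; rewrite ?mulr1.
case: (boolP (elder T w)) => [/elderP[k [p [i [i' []]]]]|_]; first by rewrite Tw.
by rewrite !mulr1.
Qed.

End Statistics.

Section QPolynomials.
Local Open Scope ring_scope.

(** First [z = 1], as in [Qnk], then the shift of [x] from the theorem. *)
Let spec : MP3 -> MP2 :=
  comp_mpoly [tuple ux - ut - 1; ut] \o comp_mpoly [tuple ux; 1; ut].

Lemma map_Q m : map_poly spec (Qaux m) = Q_poly ux ut m.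
Proof.
have spec_x : spec vx = ux - ut - 1.
  by rewrite /spec /= /vx comp_mpolyXU /= /ux comp_mpolyXU.
have spec_z : spec vz = 1.
  by rewrite /spec /= /vz comp_mpolyXU /= comp_mpoly1.
have spec_t : spec vt = ut.
  by rewrite /spec /= /vt comp_mpolyXU /= /ut comp_mpolyXU.
elim: m => [|m IHm]; first by rewrite /= rmorph1.
rewrite /= /Qstep /Q_step -IHm deriv_map.
rewrite !(rmorphD, rmorphM, rmorph_nat) /= !map_polyC map_polyX /=.
rewrite -![comp_mpoly _ (comp_mpoly _ _)]/(spec _) spec_x spec_z spec_t.
move: (map_poly _ _) (map_poly _ _) => p q.
rewrite !(rmorphD, rmorphN, rmorphB, rmorphM, rmorph_nat, rmorph1) /= -!natr1.
ring.
Qed.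

Lemma QnkE n k : Qnk n k \mPo [tuple ux - ut - 1; ut] = (Q_poly ux ut n.-1)`_k.
Proof.
by rewrite -map_Q /Qnk /Q coef_map coef_map.
Qed.

End QPolynomials.

Local Open Scope ring_scope.

Theorem theorem2p2 (n k : nat) (hn : (1 <= n)%N) (hk : (k <= n - 1)%N) :
  Qnk n k \mPo [tuple ux - ut - 1; ut] =
  \sum_(T in Pset n k) ux ^+ youngAt T 0 * ut ^+ eld T.
Proof.
case: n hn hk => // n _ _; rewrite QnkE /= -tree_poly1 -below_sumT /below_sum.
(* Every [beta] is below the number of labels, so the last threshold excludes no tree. *)
rewrite coef_sum (eq_bigl (@is_plane_tree n.+1)) => [|T]; last first.
  rewrite plane_tree_onT; apply/belowP/idP => [[]//|PT]; split=> // w _.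
  exact: beta_ltn.
rewrite [RHS](eq_bigl (fun T => is_plane_tree T && (nimproper T == k))); last first.
  by move=> T; rewrite inE.
rewrite [RHS]big_mkcondr; apply: eq_bigr => T _.
(* Here [y] is the polynomial variable, so the coefficient of degree [k] selects the trees with [k]
   improper edges. *)
rewrite tree_weightE -!rmorphXn -rmorphM /= coefCM coefXn eq_sym.
by case: eqP => _; rewrite ?mulr1 ?mulr0.
Qed.
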